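(* For each positive integer $n$, let two permutations of $n$ letters be chosen independently and uniformly at random from the set of all $n!$ permutations of $n$ letters, and let $p_n$ be the probability that the two permutations have the same number of cycles. Then $$p_n \sim \frac{1}{2\sqrt{\pi\log n}}\qquad (n\to\infty).$$
   Context: The number of cycles of a permutation is the number of cycles in its disjoint cycle decomposition, where fixed points are counted as cycles of length 1. Here $\log$ is the natural logarithm, and $a_n\sim b_n$ as $n\to\infty$ means $\lim_{n\to\infty} a_n/b_n=1$. *)

(* Defs.v *)
From mathcomp Require Import all_boot all_order all_fingroup all_algebra.
From mathcomp Require Import all_classical all_reals all_analysis.

Set Implicit Arguments.
Unset Strict Implicit.
Unset Printing Implicit Defensive.

Import Order.TTheory GRing.Theory Num.Theory.
Import numFieldNormedType.Exports.

Local Open Scope ring_scope.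
Local Open Scope classical_set_scope.

(* [porbits s] contains the singleton orbit of every fixed point of [s], so
   fixed points count as cycles of length 1. *)
Definition num_cycles (n : nat) (s : 'S_n) : nat := #|porbits s|.

(* By independence, a pair of permutations has probability
   (1 / n!) * (1 / n!). *)
Definition prob_same_num_cycles (R : realType) (n : nat) : R :=
  \sum_(st : 'S_n * 'S_n | num_cycles st.1 == num_cycles st.2)
    (n`!%:R^-1 * n`!%:R^-1).

Definition asymp_equiv (R : realType) (a b : nat -> R) : Prop :=
  (fun n => a n / b n) @ \oo --> (1 : R).

(* Main.v *)
Require Import Defs.
From mathcomp Require Import all_boot all_order all_fingroup all_algebra.
From mathcomp Require Import all_classical all_reals all_analysis.
From mathcomp Require Import ring lra zify.

Import Order.TTheory GRing.Theory Num.Theory.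
Import numFieldNormedType.Exports.

Set Implicit Arguments.
Unset Strict Implicit.
Unset Printing Implicit Defensive.

Local Open Scope ring_scope.

(** The homogeneous cycle polynomial of the symmetric group factors:
    $\sum_s x^{c(s)} y^{n-c(s)} = \prod_{i<n} (x + i y)$
    ([sum_num_cycles]).  Taking the product of its specialisations at [(X, 1)]
    and at [(1, X)], the coefficient of [X^n] counts the pairs of permutations
    with equally many cycles, hence
    $p_n = [X^n] \prod_{i<n} (X + i)(1 + i X) / (i+1)^2$.
    With $r_i = 2i/(i+1)^2$ each factor is
    $(1 - r_i) X + r_i (1 + X^2)/2$, the generating function (shifted by one
    to avoid negative exponents) of a lazy step of the simple random walk on
    the integers: it stays put with probability $1 - r_i$ and otherwise moves
    by $\pm 1$ with equal chances.  So $p_n$ is the mean of $u_N$, where [N]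
    is a sum of independent Bernoulli variables of parameters
    $r_0, \dots, r_{n-1}$ and $u_m$ is the probability that the simple walk is
    back at its origin after [m] steps ([prob_same_num_cycles_mean]).

    Parity would be an obstacle, since $u_m = 0$ for odd [m]; but
    $r_1 = 1/2$, so conditioning on that one variable replaces [u] by the
    average of two consecutive values: $2 p_n$ is the mean of
    $u_{N'} + u_{N'+1}$, with $N'$ using only the indices from 2 on
    ([prob_same_num_cycles_fair_split]).  The return probabilities are, up to
    the factor $2/\pi$, Wallis integrals, and the monotonicity of these gives
    $\sqrt{2/\pi}/\sqrt{m+2} \le u_m + u_{m+1} \le \sqrt{2/\pi}/\sqrt m$,
    the second inequality for $m \ge 1$.

    Let $\mu$ be the mean of $N'$; its variance is at most $\mu$.  The lower
    bound is convex, so Jensen's inequality, in the form of its tangent at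
    $\mu + 2$, bounds the mean below by $\sqrt{2/\pi}/\sqrt{\mu+2}$.  For
    the upper bound, $1/\sqrt m$ lies below its tangent at $\mu$ plus a
    multiple of $(m-\mu)^2/\mu^2$, which costs only $O(1/\mu)$ on average.
    Finally $\mu = 2 \log n + O(1)$ ([cycle_mean_bounds]), so that
    $2 p_n \sim 1/\sqrt{\pi \log n}$. *)

(** * Counting permutations by cycles *)

Lemma porbit_lift_perm (n : nat) (t : 'S_n) (k : 'I_n) :
  porbit (lift_perm ord0 ord0 t) (lift ord0 k) = lift ord0 @: porbit t k.
Proof.
have expE i : (lift_perm ord0 ord0 t ^+ i)%g = lift_perm ord0 ord0 (t ^+ i)%g.
  by elim: i => [|i IHi]; rewrite ?expg0 ?lift_perm1 // !expgS IHi lift_permM.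
apply/finset.setP => z; apply/porbitP/imsetP => [[i ->]|[_ /porbitP[i ->] ->]].
  by rewrite expE lift_perm_lift; exists ((t ^+ i)%g k); rewrite ?mem_porbit.
by exists i; rewrite expE lift_perm_lift.
Qed.

Lemma porbit_lift_perm0 (n : nat) (t : 'S_n) :
  porbit (lift_perm ord0 ord0 t) ord0 = [set ord0].
Proof.
apply/finset.setP => z; rewrite finset.in_set1.
apply/porbitP/eqP => [[i ->]|->].
  by elim: i => [|i IHi]; rewrite ?perm1 // expgSr permM IHi lift_perm_id.
by exists 0%N; rewrite perm1.
Qed.

Lemma num_cycles_lift_perm (n : nat) (t : 'S_n) :
  num_cycles (lift_perm ord0 ord0 t) = (num_cycles t).+1.
Proof.
rewrite /num_cycles.
have -> : porbits (lift_perm ord0 ord0 t)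
          = [set ord0] |: [set lift ord0 @: (A : {set 'I_n}) | A in porbits t].
  apply/finset.setP => B; rewrite finset.in_setU1; apply/imsetP/orP.
    move=> [z _ ->]; case: (unliftP ord0 z) => [k|] ->; last first.
      by left; rewrite porbit_lift_perm0.
    by right; rewrite porbit_lift_perm imset_f ?imset_f.
  move=> [/eqP ->|/imsetP[_ /imsetP[k _ ->] ->]].
    by exists ord0; rewrite ?porbit_lift_perm0.
  by exists (lift ord0 k); rewrite ?porbit_lift_perm.
rewrite cardsU1 card_imset; last by apply: imset_inj; exact: lift_inj.
rewrite [_ \notin _](_ : _ = true) //.
apply/imsetP => -[A _ /finset.setP/(_ ord0)].
by rewrite set11 => /esym/imsetP[k _ /eqP]; rewrite eq_liftF.
Qed.

Lemma num_cycles_tperm_lift (n : nat) (i : 'I_n.+1) (t : 'S_n) :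
  num_cycles (tperm ord0 i * lift_perm ord0 ord0 t)%g
  = (num_cycles t + (i == ord0))%N.
Proof.
have /= := porbits_mul_tperm (lift_perm ord0 ord0 t) ord0 i.
rewrite -/(num_cycles _) -/(num_cycles _) num_cycles_lift_perm.
rewrite porbit_sym porbit_lift_perm0 finset.in_set1 (eq_sym ord0 i).
by case: (i == ord0) => /=; lia.
Qed.

(** Every permutation factors uniquely as the transposition that moves [ord0]
    to the right place after a permutation of the other letters. *)
Lemma sum_perm_recl (V : nmodType) (n : nat) (F : 'S_n.+1 -> V) :
  \sum_s F s = \sum_(i < n.+1) \sum_(t : 'S_n)
    F (tperm ord0 i * lift_perm ord0 ord0 t)%g.
Proof.
rewrite pair_bigA /=.
pose h (p : 'I_n.+1 * 'S_n) : 'S_n.+1 :=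
  (tperm ord0 p.1 * lift_perm ord0 ord0 p.2)%g.
rewrite (reindex h) //; apply: onW_bij; apply: inj_card_bij; last first.
  by rewrite card_prod card_ord !card_Sn factS.
move=> [i s] [j t] /= eq_h.
have eij : i = j.
  have := congr1 (fun u : 'S_n.+1 => (u^-1)%g ord0) eq_h.
  by rewrite !invMg !permM !lift_permV !lift_perm_id !tpermV !tpermL.
move: eq_h; rewrite /h eij /= => /mulgI eq_l.
congr pair; apply/permP => k; apply: (@lift_inj _ ord0).
by rewrite -!(lift_perm_lift ord0) eq_l.
Qed.

Lemma num_cycles_le (n : nat) (s : 'S_n) : (num_cycles s <= n)%N.
Proof. by rewrite -[X in (_ <= X)%N]card_ord; exact: leq_imset_card. Qed.

(** Left multiplication by [tperm ord0 i], for nonzero [i], merges the fixed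
    point [ord0] with the cycle of [i], so that one choice of [i] adds a cycle
    and the [n] others keep their number: hence the factor [x + n y].  Keeping
    the second variable [y] gives the reversed polynomial at no cost. *)
Lemma sum_num_cycles (A : comNzRingType) (n : nat) (x y : A) :
  \sum_(s : 'S_n) x ^+ num_cycles s * y ^+ (n - num_cycles s)
  = \prod_(i < n) (x + i%:R * y).
Proof.
elim: n => [|n IHn].
  have S0 (s : 'S_0) : s = 1%g by apply/permP => -[].
  rewrite big_ord0 (big_pred1 1%g) => [|s]; last by rewrite (S0 s) /= eqxx.
  have /eqP -> : num_cycles (1%g : 'S_0) == 0%N by rewrite -leqn0 num_cycles_le.
  by rewrite !expr0 mulr1.
rewrite sum_perm_recl [RHS]big_ord_recr /= -IHn big_ord_recl /=.
rewrite mulrDr; congr (_ + _).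
  rewrite mulr_suml; apply: eq_bigr => t _.
  by rewrite num_cycles_tperm_lift eqxx addn1 subSS exprS -mulrA mulrC.
rewrite (eq_bigr (fun=> \sum_(t : 'S_n)
    x ^+ num_cycles t * y ^+ (n.+1 - num_cycles t))); last first.
  move=> i _; apply: eq_bigr => t _.
  by rewrite num_cycles_tperm_lift lift_eqF addn0.
have -> : \sum_(t : 'S_n) x ^+ num_cycles t * y ^+ (n.+1 - num_cycles t)
    = (\sum_(t : 'S_n) x ^+ num_cycles t * y ^+ (n - num_cycles t)) * y.
  rewrite mulr_suml; apply: eq_bigr => t _.
  by rewrite subSn ?num_cycles_le // exprSr mulrA.
by rewrite sumr_const card_ord mulrCA mulr_natl.
Qed.

(** * Means of sums of Bernoulli variables *)

(** The mean of [f N], for [N] a sum of independent Bernoulli variables with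
    parameters [rs], computed by conditioning on the first variable. *)
Fixpoint bernoulli_mean (R : pzRingType) (rs : seq R) (f : nat -> R) : R :=
  if rs is r :: rs' then
    (1 - r) * bernoulli_mean rs' f
    + r * bernoulli_mean rs' (fun m => f m.+1)
  else f 0%N.

Lemma eq_bernoulli_mean (R : pzRingType) (rs : seq R) (f g : nat -> R) :
  f =1 g -> bernoulli_mean rs f = bernoulli_mean rs g.
Proof.
elim: rs f g => [|r rs IHrs] f g fg /=; first exact: fg.
by rewrite (IHrs f g) // (IHrs (fun m => f m.+1) (fun m => g m.+1)).
Qed.

Lemma bernoulli_mean_linear (R : comPzRingType) (rs : seq R) (a b : R)
    (f g : nat -> R) :
  bernoulli_mean rs (fun m => a * f m + b * g m)
  = a * bernoulli_mean rs f + b * bernoulli_mean rs g.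
Proof.
elim: rs f g => [|r rs IHrs] f g //=.
by rewrite IHrs (IHrs (fun m => f m.+1)); ring.
Qed.

Lemma le_bernoulli_mean (R : numDomainType) (rs : seq R) (f g : nat -> R) :
  (forall r, r \in rs -> 0 <= r <= 1) -> (forall m, f m <= g m) ->
  bernoulli_mean rs f <= bernoulli_mean rs g.
Proof.
elim: rs f g => [|r rs IHrs] f g rs01 fg /=; first exact: fg.
have /andP[r0 r1] := rs01 r (mem_head _ _).
have {}IHrs f' g' : (forall m, f' m <= g' m) ->
    bernoulli_mean rs f' <= bernoulli_mean rs g'.
  by apply: IHrs => s s_rs; apply: rs01; rewrite in_cons s_rs orbT.
by rewrite lerD ?ler_wpM2l ?subr_ge0 ?IHrs.
Qed.

(** The first two moments of a sum of independent Bernoulli variables: its mean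
    is the sum of the [r] and its variance the sum of the [r * (1 - r)]. *)
Lemma bernoulli_mean_quadratic (R : comPzRingType) (rs : seq R) (a b c : R) :
  bernoulli_mean rs (fun m => a + b * m%:R + c * m%:R ^+ 2)
  = a + b * \sum_(r <- rs) r
    + c * ((\sum_(r <- rs) r) ^+ 2 + \sum_(r <- rs) r * (1 - r)).
Proof.
elim: rs a b c => [|r rs IHrs] a b c /=; first by rewrite !big_nil; ring.
rewrite IHrs (@eq_bernoulli_mean _ _ _
  (fun m => (a + b + c) + (b + c + c) * m%:R + c * m%:R ^+ 2)); last first.
  by move=> m; rewrite -natr1; ring.
by rewrite IHrs !big_cons; ring.
Qed.

(** * Random walks and pairs of permutations *)

(** One step of the simple random walk, [(X + X^-1) / 2], multiplied by [X]. *)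
Definition fair_step (R : fieldType) : {poly R} := (2^-1)%:P * ('X^2 + 1).
Arguments fair_step {R}.

(** Each step being shifted by one, the origin sits at exponent [m] after [m]
    steps. *)
Definition return_prob (R : fieldType) (m : nat) : R := (fair_step ^+ m)`_m.
Arguments return_prob {R}.

(** Lazy steps that stay put do not change the position, so a product of lazy
    steps is a mixture of powers of the fair step.  The extra factor
    [fair_step ^+ l] makes the induction on [rs] go through. *)
Lemma coef_lazy_walk (R : fieldType) (rs : seq R) (l : nat) :
  (\prod_(r <- rs) ((1 - r)%:P * 'X + r%:P * fair_step)
     * fair_step ^+ l)`_(size rs + l)
  = bernoulli_mean rs (fun m => return_prob (m + l)).
Proof.
elim: rs l => [|r rs IHrs] l /=; first by rewrite big_nil mul1r.
rewrite big_cons.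
set P := \prod_(_ <- _) _.
have -> : ((1 - r)%:P * 'X + r%:P * fair_step) * P * fair_step ^+ l
    = (1 - r)%:P * ('X * (P * fair_step ^+ l)) + r%:P * (P * fair_step ^+ l.+1).
  rewrite exprS; move: (@fair_step R ^+ l) (@fair_step R) P => h g P.
  by move: (1 - r)%:P r%:P => c d; ring.
rewrite coefD !coefCM coefXM addSn /= IHrs -addnS IHrs.
by congr (_ + _ * _); apply: eq_bernoulli_mean => m; rewrite addnS.
Qed.

Lemma return_probE (R : fieldType) (m : nat) :
  return_prob m = 2 ^- m * (if odd m then 0 else 'C(m, m./2)%:R) :> R.
Proof.
rewrite /return_prob /fair_step exprMn -polyC_exp coefCM exprVn.
rewrite (exprD1n ('X^2)) coef_sum; congr (_ * _).
under eq_bigr do rewrite coefMn -exprM coefXn.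
case: ifP => [m_odd|/negbT m_even].
  apply: big1 => i _; case: eqP => [mE|]; last by rewrite mul0rn.
  by have := congr1 odd mE; rewrite m_odd mul2n odd_double.
have m2 : (m./2 < m.+1)%N by lia.
rewrite (bigD1 (Ordinal m2)) //= big1 ?addr0 => [|i ne_i].
  by rewrite mul2n even_halfK // eqxx.
case: eqP => [mE|]; last by rewrite mul0rn.
by case/eqP: ne_i; apply: val_inj => /=; lia.
Qed.

Lemma bin_central_rec (k : nat) :
  (k.+1 * 'C(k.+1.*2, k.+1) = 2 * (k.*2.+1 * 'C(k.*2, k)))%N.
Proof.
have /= e1 := mul_bin_diag k.*2.+2 k.
have /= e2 := mul_bin_diag k.*2.+1 k.
have e3 : 'C(k.*2.+1, k) = 'C(k.*2.+1, k.+1).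
  by rewrite -bin_sub; [congr 'C(_, _); lia | lia].
by rewrite doubleS -e1 e3 e2; lia.
Qed.

Lemma return_prob_rec (R : numFieldType) (k : nat) :
  return_prob k.+1.*2 = k.*2.+1%:R / k.*2.+2%:R * return_prob k.*2 :> R.
Proof.
have := congr1 (fun a : nat => a%:R : R) (bin_central_rec k).
rewrite /= 3!natrM => binE.
have -> : k.*2.+2%:R = 2 * k.+1%:R :> R by rewrite -natrM -doubleS mul2n.
rewrite !return_probE !odd_double !doubleK doubleS !exprS -doubleS.
apply: (mulfI (_ : k.+1%:R != 0 :> R)); first by rewrite pnatr_eq0.
rewrite mulrCA binE; field.
by rewrite expf_neq0 ?pnatr_eq0 //= addrC natr1 pnatr_eq0.
Qed.

(** A pair [(s, t)] contributes the monomial of exponent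
    [num_cycles s + (n - num_cycles t)], which is [n] exactly when both
    permutations have the same number of cycles. *)
Lemma prob_same_num_cycles_coef (R : realType) (n : nat) :
  prob_same_num_cycles R n
  = (n`!%:R^-1 * n`!%:R^-1)
    * (\prod_(i < n) ('X + i%:R * 1) * \prod_(i < n) (1 + i%:R * 'X)
       : {poly R})`_n.
Proof.
rewrite -!sum_num_cycles mulr_suml coef_sum mulr_sumr.
rewrite /prob_same_num_cycles big_mkcond -(pair_bigA _ (fun s t =>
  if num_cycles s == num_cycles t then n`!%:R^-1 * n`!%:R^-1 else 0)) /=.
apply: eq_bigr => s _; rewrite mulr_sumr coef_sum mulr_sumr.
apply: eq_bigr => t _; rewrite !expr1n mulr1 mul1r -exprD coefXn.
have -> : (n == (num_cycles s + (n - num_cycles t))%N)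
          = (num_cycles s == num_cycles t).
  rewrite [RHS]eq_sym -[RHS](eqn_add2r (n - num_cycles t)).
  by rewrite subnKC ?num_cycles_le.
by case: eqP => _; rewrite ?mulr1 ?mulr0.
Qed.

(** Twice the variance [p * (1 - p)] of a Bernoulli variable of parameter
    [p = 1 / (i + 1)]: the probability that two independent copies differ. *)
Definition cycle_rate (R : fieldType) (i : nat) : R := 2 * i%:R / i.+1%:R ^+ 2.
Arguments cycle_rate {R}.

Lemma prob_same_num_cycles_mean (R : realType) (n : nat) :
  prob_same_num_cycles R n
  = bernoulli_mean [seq cycle_rate i | i <- iota 0 n] return_prob.
Proof.
under eq_bernoulli_mean do rewrite -[X in return_prob X]addn0.
rewrite -coef_lazy_walk size_map size_iota addn0 expr0 mulr1.
rewrite prob_same_num_cycles_coef -coefCM; congr (polyseq _)`_n.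
rewrite big_map -[in RHS](subn0 n) big_mkord -big_split /=.
have -> : n`!%:R^-1 * n`!%:R^-1 = \prod_(i < n) (i.+1%:R ^- 2) :> R.
  rewrite fact_prod big_add1 /= big_mkord natr_prod -prodfV -big_split /=.
  by apply: eq_bigr => i _; rewrite -invfM.
rewrite rmorph_prod -big_split /=.
apply: eq_bigr => i _.
have i_neq0 : i.+1%:R != 0 :> R by rewrite pnatr_eq0.
have -> : 1 - cycle_rate i = (1 + i%:R ^+ 2) / i.+1%:R ^+ 2 :> R.
  by rewrite /cycle_rate -natr1; field; rewrite addrC natr1.
have -> : cycle_rate i = i%:R / i.+1%:R ^+ 2 * 2 :> R.
  by rewrite /cycle_rate; ring.
rewrite /fair_step [_%:P * (_%:P * _)]mulrA -polyCM mulfK ?pnatr_eq0 // !polyCM.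
move: (i.+1%:R ^- 2)%:P => c.
rewrite polyCD polyC_exp polyC1 polyC_natr.
by ring.
Qed.

(** The variable of rate [cycle_rate 1 = 1 / 2] is a fair coin that decides the
    parity of the number of effective steps. *)
Lemma prob_same_num_cycles_fair_split (R : realType) (k : nat) :
  prob_same_num_cycles R k.+2
  = bernoulli_mean [seq cycle_rate i | i <- iota 2 k]
      (fun m => return_prob m + return_prob m.+1) / 2.
Proof.
rewrite prob_same_num_cycles_mean /=.
under [in RHS]eq_bernoulli_mean
  do rewrite -[return_prob _]mul1r -[X in _ + X]mul1r.
rewrite bernoulli_mean_linear.
have -> : cycle_rate 0 = 0 :> R by rewrite /cycle_rate mulr0 mul0r.
have -> : cycle_rate 1 = 2^-1 :> R by rewrite /cycle_rate; field.
by field.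
Qed.

(** * Wallis integrals *)

(** The reduction formula for the primitive of [cos ^+ n] that vanishes at 0,
    taken as a definition: it gives Wallis integrals without integration. *)
Fixpoint cos_pow_prim (R : realType) (n : nat) (x : R) {struct n} : R :=
  match n with
  | 0 => x
  | 1 => sin x
  | (m.+1 as p).+1 =>
      cos x ^+ p * sin x / m.+2%:R + m.+1%:R / m.+2%:R * cos_pow_prim m x
  end.

Lemma is_derive_cos_pow_prim (R : realType) (n : nat) (x : R) :
  is_derive x 1 (cos_pow_prim n) (cos x ^+ n).
Proof.
suff: is_derive x 1 (cos_pow_prim n) (cos x ^+ n) /\
      is_derive x 1 (cos_pow_prim n.+1) (cos x ^+ n.+1) by case.
elim: n => [|n [IHn IHSn]].
  by split; [rewrite expr0|rewrite expr1]; apply: is_derive_eq.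
split=> //.
have -> : cos_pow_prim n.+2 =
    n.+2%:R^-1 *: (cos ^+ n.+1 * sin)
    + n.+1%:R / n.+2%:R *: cos_pow_prim n :> (R -> R).
  by apply/funext => y; rewrite !fctE /= mulrC.
apply: is_derive_eq.
rewrite !fctE /GRing.scale /=.
have -> : sin x * (n.+1%:R * cos x ^+ n * - sin x)
    = - (n.+1%:R * cos x ^+ n * sin x ^+ 2) by ring.
rewrite sin2cos2 !exprS -!natr1.
field.
by rewrite !natr1 pnatr_eq0.
Qed.

(** The integral of [cos ^+ n] between [0] and [pi / 2]. *)
Definition wallis (R : realType) (n : nat) : R := cos_pow_prim n (pi / 2).
Arguments wallis {R}.

Lemma wallis_rec (R : realType) (n : nat) :
  wallis n.+2 = n.+1%:R / n.+2%:R * wallis n :> R.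
Proof. by rewrite /wallis /= cos_pihalf expr0n /= mul0r mul0r add0r. Qed.

(** The difference of the two primitives has derivative
    [cos x ^+ n * (1 - cos x)], which is nonnegative up to [pi / 2]. *)
Lemma wallis_noninc (R : realType) (n : nat) : wallis n.+1 <= wallis n :> R.
Proof.
have prim0 m : cos_pow_prim m (0 : R) = 0.
  suff [] : cos_pow_prim m (0 : R) = 0 /\ cos_pow_prim m.+1 (0 : R) = 0 by [].
  elim: m => [|m [IHm IHSm]]; first by rewrite /= sin0.
  by split=> //=; rewrite sin0 IHm !(mulr0, mul0r, addr0).
pose g (x : R) := cos_pow_prim n x - cos_pow_prim n.+1 x.
have dg (x : R) : is_derive x 1 g (cos x ^+ n - cos x ^+ n.+1).
  have := is_derive_cos_pow_prim n x.
  have := is_derive_cos_pow_prim n.+1 x.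
  by move=> ? ?; apply: is_deriveB.
rewrite -subr_ge0.
have <- : g 0 = 0 by rewrite /g !prim0 subr0.
apply: (@ger0_derive1_le_cc _ g 0 (pi / 2)).
- by move=> x _; apply: ex_derive.
- move=> x; rewrite in_itv /= => /andP[x0 x1]; rewrite derive1E derive_val.
  rewrite exprSr -[X in X - _]mulr1 -mulrBr.
  rewrite mulr_ge0 ?exprn_ge0 ?subr_ge0 ?cos_le1 //.
  by apply: cos_ge0_pihalf; have := pi_gt0 R; lra.
- by apply: derivable_within_continuous => x _; apply: ex_derive.
- by rewrite in_itv /= lexx; have := pi_gt0 R; lra.
- by rewrite in_itv /= lexx; have := pi_gt0 R; lra.
- by have := pi_gt0 R; lra.
Qed.

(** By the recurrence, [n.+1%:R * wallis n * wallis n.+1] does not depend on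
    [n]; monotonicity then locates each factor. *)
Lemma wallis_prod (R : realType) (n : nat) :
  wallis n * wallis n.+1 = pi / (2 * n.+1%:R) :> R.
Proof.
elim: n => [|n IHn]; first by rewrite /wallis /= sin_pihalf !mulr1.
rewrite wallis_rec mulrCA [wallis _ * _]mulrC IHn.
by field; rewrite !(addrC _ n%:R) natr1 -natrD !pnatr_eq0 addnS.
Qed.

Lemma wallis_gt0 (R : realType) (n : nat) : 0 < wallis n :> R.
Proof.
have W0 : 0 < wallis 0 :> R by rewrite divr_gt0 ?pi_gt0.
elim: n => // n IHn.
by rewrite -(pmulr_rgt0 _ IHn) wallis_prod divr_gt0 ?pi_gt0 ?mulr_gt0.
Qed.

Lemma wallis_sqr_le (R : realType) (n : nat) :
  wallis n.+1 ^+ 2 <= pi / (2 * n.+1%:R) :> R.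
Proof. by rewrite -wallis_prod expr2 ler_pM2r ?wallis_gt0 ?wallis_noninc. Qed.

Lemma wallis_sqr_ge (R : realType) (n : nat) :
  pi / (2 * n.+1%:R) <= wallis n ^+ 2 :> R.
Proof. by rewrite -wallis_prod expr2 ler_pM2l ?wallis_gt0 ?wallis_noninc. Qed.

(** * The mean return probability *)

Lemma return_prob_wallis (R : realType) (k : nat) :
  return_prob k.*2 = 2 / pi * wallis k.*2 :> R.
Proof.
elim: k => [|k IHk].
  rewrite return_probE /= bin0 expr0 invr1 mul1r /wallis /=.
  by move: (@pi R) (lt0r_neq0 (pi_gt0 R)) => p p0; field.
by rewrite return_prob_rec IHk doubleS wallis_rec; ring.
Qed.

Lemma return_prob_odd (R : realType) (k : nat) : return_prob k.*2.+1 = 0 :> R.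
Proof. by rewrite return_probE /= odd_double mulr0. Qed.

(** Only the even one of [m] and [m.+1] contributes, so the sum is a Wallis
    integral whose index is [m] or [m.+1]. *)
Lemma return_prob_pair (R : realType) (m : nat) :
  (2 / pi * wallis m.+1 : R) <= return_prob m + return_prob m.+1
    <= (2 / pi * wallis m : R).
Proof.
have c_ge0 : 0 <= 2 / pi :> R by rewrite divr_ge0 ?pi_ge0.
rewrite -(odd_double_half m); case: (odd m) => /=.
  rewrite add1n return_prob_odd add0r -doubleS return_prob_wallis doubleS lexx.
  by rewrite ler_wpM2l ?wallis_noninc.
rewrite add0n return_prob_odd addr0 return_prob_wallis lexx andbT.
by rewrite ler_wpM2l ?wallis_noninc.
Qed.

Lemma return_prob_pair_ge (R : realType) (m : nat) :
  Num.sqrt (2 / pi) / Num.sqrt m.+2%:R <= return_prob m + return_prob m.+1 :> R.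
Proof.
have pi0 := pi_gt0 R.
have /andP[+ _] := return_prob_pair R m; apply: le_trans.
rewrite -sqrtrV ?ler0n // -sqrtrM ?divr_ge0 ?(ltW pi0) //.
have -> : 2 / pi * wallis m.+1 = Num.sqrt ((2 / pi * wallis m.+1) ^+ 2) :> R.
  rewrite sqrtr_sqr ger0_norm //.
  by rewrite mulr_ge0 ?divr_ge0 ?(ltW pi0) ?ltW ?wallis_gt0.
rewrite ler_sqrt ?sqr_ge0 // exprMn.
apply: le_trans (_ : (2 / pi) ^+ 2 * (pi / (2 * m.+2%:R)) <= _).
  rewrite le_eqVlt; apply/orP; left; apply/eqP.
  have m0 : m.+2%:R != 0 :> R by rewrite pnatr_eq0.
  move: (@pi R) (lt0r_neq0 pi0) m.+2%:R m0 => p p0 a a0.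
  by field; rewrite ?p0 ?a0.
by rewrite ler_wpM2l ?sqr_ge0 ?wallis_sqr_ge.
Qed.

Lemma return_prob_pair_le (R : realType) (m : nat) :
  return_prob m.+1 + return_prob m.+2
    <= Num.sqrt (2 / pi) / Num.sqrt m.+1%:R :> R.
Proof.
have pi0 := pi_gt0 R.
have /andP[_ le_w] := return_prob_pair R m.+1; apply: (le_trans le_w).
rewrite -sqrtrV ?ler0n // -sqrtrM ?divr_ge0 ?(ltW pi0) //.
have -> : 2 / pi * wallis m.+1 = Num.sqrt ((2 / pi * wallis m.+1) ^+ 2) :> R.
  rewrite sqrtr_sqr ger0_norm //.
  by rewrite mulr_ge0 ?divr_ge0 ?(ltW pi0) ?ltW ?wallis_gt0.
rewrite ler_sqrt ?mulr_ge0 ?invr_ge0 ?ler0n ?(ltW pi0) // exprMn.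
apply: le_trans (_ : _ <= (2 / pi) ^+ 2 * (pi / (2 * m.+1%:R))) _.
  by rewrite ler_wpM2l ?sqr_ge0 ?wallis_sqr_le.
rewrite le_eqVlt; apply/orP; left; apply/eqP.
have m0 : m.+1%:R != 0 :> R by rewrite pnatr_eq0.
move: (@pi R) (lt0r_neq0 pi0) m.+1%:R m0 => p p0 a a0.
by field; rewrite ?p0 ?a0.
Qed.

(** The convex function [x |-> 1 / sqrt x] lies above its tangent at [a]; in the
    variables [b = sqrt a] and [y = sqrt x], the gap is an explicit multiple of
    [(b - y) ^+ 2]. *)
Lemma inv_sqrt_ge_tangent (R : rcfType) (a x : R) : 0 < a -> 0 < x ->
  (Num.sqrt a)^-1 - (x - a) / (2 * a * Num.sqrt a) <= (Num.sqrt x)^-1.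
Proof.
move=> a0 x0.
suff sqr_ge (b y : R) : 0 < b -> 0 < y ->
    b^-1 - (y ^+ 2 - b ^+ 2) / (2 * b ^+ 2 * b) <= y^-1.
  by have := sqr_ge (Num.sqrt a) (Num.sqrt x);
    rewrite !sqr_sqrtr ?(ltW a0) ?(ltW x0) // !sqrtr_gt0; apply.
move=> b0 y0; rewrite -subr_ge0.
have -> : y^-1 - (b^-1 - (y ^+ 2 - b ^+ 2) / (2 * b ^+ 2 * b))
  = (b - y) ^+ 2 * (2 * b + y) / (2 * y * b ^+ 3).
  by field; rewrite !lt0r_neq0.
have num_ge0 : 0 <= 2 * b + y by lra.
have den_ge0 : 0 <= 2 * y * b ^+ 3.
  by rewrite !mulr_ge0 ?exprn_ge0 ?(ltW b0) ?(ltW y0).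
by rewrite divr_ge0 // mulr_ge0 ?sqr_ge0.
Qed.

(** A converse to the tangent bound.  The second derivative at [a], of order
    [a ^- (5/2)], would be too small a coefficient: when [x] stays bounded and
    [a] is large, the left-hand side has order 1 and [(x - a) ^+ 2] only order
    [a ^+ 2], which forces [a ^- 2]. *)
Lemma inv_sqrt_le_quadratic (R : rcfType) (a x : R) : 0 < a -> 1 <= x ->
  (Num.sqrt x)^-1
    <= (Num.sqrt a)^-1 - (x - a) / (2 * a * Num.sqrt a) + (x - a) ^+ 2 / a ^+ 2.
Proof.
move=> a0 x1; have x0 : 0 < x by lra.
suff sqr_le (b y : R) : 0 < b -> 1 <= y ->
    y^-1 <= b^-1 - (y ^+ 2 - b ^+ 2) / (2 * b ^+ 2 * b)
      + (y ^+ 2 - b ^+ 2) ^+ 2 / (b ^+ 2) ^+ 2.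
  have := sqr_le (Num.sqrt a) (Num.sqrt x).
  rewrite !sqr_sqrtr ?(ltW a0) ?(ltW x0) // sqrtr_gt0; apply=> //.
  by rewrite -[1]sqrtr1 ler_sqrt ?(ltW x0).
move=> b0 y1; have y0 : 0 < y by lra.
rewrite -subr_ge0.
have -> : b^-1 - (y ^+ 2 - b ^+ 2) / (2 * b ^+ 2 * b)
      + (y ^+ 2 - b ^+ 2) ^+ 2 / (b ^+ 2) ^+ 2 - y^-1
  = (b - y) ^+ 2 * (2 * y * (b + y) ^+ 2 - b * (2 * b + y)) / (2 * y * b ^+ 4).
  by field; rewrite !lt0r_neq0.
have num_ge0 : 0 <= 2 * y * (b + y) ^+ 2 - b * (2 * b + y).
  have -> : 2 * y * (b + y) ^+ 2 - b * (2 * b + y)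
      = 2 * ((y - 1) * (b + y) ^+ 2) + 3 * (b * y) + 2 * y ^+ 2 by ring.
  have := sqr_ge0 y; have : 0 <= b * y by rewrite mulr_ge0 ?ltW.
  have : 0 <= (y - 1) * (b + y) ^+ 2 by rewrite mulr_ge0 ?sqr_ge0 ?subr_ge0.
  by lra.
have den_ge0 : 0 <= 2 * y * b ^+ 4.
  by rewrite !mulr_ge0 ?exprn_ge0 ?(ltW b0) ?(ltW y0).
by rewrite divr_ge0 // mulr_ge0 ?sqr_ge0.
Qed.

(** Jensen's inequality for [x |-> 1 / sqrt (x + 2)]: the mean of the tangent at
    the mean is the value of the function there. *)
Lemma mean_return_prob_pair_ge (R : realType) (rs : seq R) :
  (forall r, r \in rs -> 0 <= r <= 1) ->
  Num.sqrt (2 / pi) / Num.sqrt (\sum_(r <- rs) r + 2)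
  <= bernoulli_mean rs (fun m => return_prob m + return_prob m.+1).
Proof.
set mu := \sum_(r <- rs) r => rs01.
have mu0 : 0 <= mu by rewrite /mu big_seq sumr_ge0 // => r /rs01/andP[].
set c := Num.sqrt (2 / pi); set b := Num.sqrt (mu + 2).
have b0 : 0 < b by rewrite sqrtr_gt0; lra.
pose s : R := c / (2 * (mu + 2) * b).
have meanE : c / b = bernoulli_mean rs
    (fun m => (c / b + s * mu) + (- s) * m%:R + 0 * m%:R ^+ 2).
  by rewrite bernoulli_mean_quadratic -/mu; ring.
rewrite meanE; apply: le_bernoulli_mean => // m.
apply: le_trans (return_prob_pair_ge R m); rewrite -/c.
have -> : c / b + s * mu + - s * m%:R + 0 * m%:R ^+ 2
  = c * (b^-1 - (m.+2%:R - (mu + 2)) / (2 * (mu + 2) * b)).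
  by rewrite /s -!natr1; ring.
rewrite ler_wpM2l ?sqrtr_ge0 //.
by apply: inv_sqrt_ge_tangent; [lra | rewrite ltr0n].
Qed.

(** The quadratic majorant is integrated exactly, and the variance of the sum
    of Bernoulli variables is at most its mean. *)
Lemma mean_return_prob_pair_le (R : realType) (rs : seq R) :
  (forall r, r \in rs -> 0 <= r <= 1) -> 0 < \sum_(r <- rs) r ->
  bernoulli_mean rs (fun m => return_prob m + return_prob m.+1)
  <= Num.sqrt (2 / pi)
     * ((Num.sqrt (\sum_(r <- rs) r))^-1 + 2 / \sum_(r <- rs) r).
Proof.
set mu := \sum_(r <- rs) r => rs01 mu0.
set c := Num.sqrt (2 / pi); set b := Num.sqrt mu.
have c0 : 0 <= c by rewrite sqrtr_ge0.
have b0 : 0 < b by rewrite sqrtr_gt0; lra.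
have pi4 : pi <= 4 :> R by have [/andP[_]] := pihalf_02_cos_pihalf R; lra.
have c2 : 1 <= 2 * c.
  have : 1 <= 2 ^+ 2 * c ^+ 2.
    by rewrite sqr_sqrtr ?divr_ge0 ?pi_ge0 // mulrA ler_pdivlMr ?pi_gt0 //; lra.
  by nra.
pose s : R := c / (2 * mu * b).
(* The coefficient 1 suffices for [1 <= m]; with 2, the majorant is also at
   least [return_prob 0 + return_prob 1 = 1] at [m = 0], as [1 <= 2 * c]. *)
pose q : R := 2 * c / mu ^+ 2.
have ub m : return_prob m + return_prob m.+1 <=
    (c / b + s * mu + q * mu ^+ 2) + (- s - q * mu *+ 2) * m%:R + q * m%:R ^+ 2.
  case: m => [|m].
    have -> : q * mu ^+ 2 = 2 * c by rewrite /q mulfVK // expf_neq0 ?lt0r_neq0.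
    rewrite (return_prob_odd R 0) addr0 return_probE /= bin0 expr0 invr1 mul1r.
    rewrite mulr0 expr0n /= mulr0 !addr0.
    have : 0 <= c / b by rewrite divr_ge0 ?(ltW b0).
    have : 0 <= s * mu.
      rewrite mulr_ge0 ?(ltW mu0) // divr_ge0 //.
      by rewrite !mulr_ge0 ?(ltW mu0) ?(ltW b0).
    by lra.
  apply: le_trans (return_prob_pair_le R m) _; rewrite -/c.
  have q0 : 0 <= c * ((m.+1%:R - mu) ^+ 2 / mu ^+ 2).
    by rewrite mulr_ge0 // divr_ge0 ?sqr_ge0.
  have m1 : 1 <= m.+1%:R :> R by rewrite ler1n.
  have := inv_sqrt_le_quadratic mu0 m1; rewrite -/b.
  move=> /(ler_wpM2l c0) /le_trans; apply.
  rewrite -subr_ge0.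
  set t := (X in 0 <= X).
  suff -> : t = c * ((m.+1%:R - mu) ^+ 2 / mu ^+ 2) by [].
  by rewrite /t /s /q; ring.
apply: le_trans (le_bernoulli_mean rs01 ub) _.
rewrite bernoulli_mean_quadratic -/mu.
have var_le : \sum_(r <- rs) r * (1 - r) <= mu.
  rewrite /mu big_seq [leRHS]big_seq; apply: ler_sum => r /rs01/andP[r0 r1].
  by rewrite ler_piMr //; lra.
set v := \sum_(r <- rs) _ in var_le *.
have -> : c / b + s * mu + q * mu ^+ 2 + (- s - q * mu *+ 2) * mu +
  q * (mu ^+ 2 + v) = c * b^-1 + q * v by ring.
rewrite mulrDr lerD2l.
have -> : c * (2 / mu) = q * mu by rewrite /q; field; rewrite lt0r_neq0.
have q0 : 0 <= q by apply: divr_ge0; [lra | exact: sqr_ge0].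
by rewrite ler_wpM2l.
Qed.

(** * The mean number of steps *)

Definition cycle_mean (R : realType) (k : nat) : R :=
  \sum_(r <- [seq cycle_rate i | i <- iota 2 k]) r.
Arguments cycle_mean {R}.

Lemma cycle_rate01 (R : realType) (i : nat) : 0 <= (cycle_rate i : R) <= 1.
Proof.
have i0 : 0 <= i%:R :> R by rewrite ler0n.
rewrite /cycle_rate divr_ge0 ?mulr_ge0 ?sqr_ge0 //=.
rewrite ler_pdivrMr ?exprn_gt0 ?ltr0n // mul1r -natr1; nra.
Qed.

Lemma ln_succ_sub_le (R : realType) (i : nat) :
  ln i.+2%:R - ln i.+1%:R <= (i.+1%:R)^-1 :> R.
Proof.
have i0 : 0 < i.+1%:R :> R by rewrite ltr0n.
rewrite -ln_div ?posrE ?ltr0n // -[i.+2%:R]natr1 mulrDl divff ?lt0r_neq0 //.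
rewrite mul1r; apply: le_ln1Dx.
have iV0 : 0 < i.+1%:R^-1 :> R by rewrite invr_gt0.
exact: lt_trans iV0.
Qed.

Lemma ln_succ_sub_ge (R : realType) (i : nat) :
  (i.+2%:R)^-1 <= ln i.+2%:R - ln i.+1%:R :> R.
Proof.
have i0 : 0 < i.+2%:R :> R by rewrite ltr0n.
rewrite -lerN2 opprB -ln_div ?posrE ?ltr0n //.
have -> : i.+1%:R / i.+2%:R = 1 + - i.+2%:R^-1 :> R.
  move: i0; rewrite -[i.+2%:R]natr1; move: i.+1%:R => a a0.
  by field; rewrite lt0r_neq0.
apply: le_ln1Dx; rewrite ltrN2 invf_lt1 // ltr1n //.
Qed.

(** For positive [i], [cycle_rate i] lies between [2 / (i + 3)] and
    [2 / (i + 1)], which logarithmic differences bound in turn; the sums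
    telescope. *)
Lemma cycle_mean_bounds (R : realType) (k : nat) :
  2 * (ln k.+2%:R - ln 5) <= (cycle_mean k : R) <= 2 * ln k.+2%:R.
Proof.
suff /andP[lo hi] : 2 * (ln k.+4.+1%:R - ln 5) <= (cycle_mean k : R)
    <= 2 * (ln k.+2%:R - ln 2).
  have : ln k.+2%:R <= ln k.+4.+1%:R :> R.
    by rewrite ler_ln ?posrE ?ltr0n ?ler_nat //; lia.
  have : 0 <= ln 2 :> R by rewrite ln_ge0 // ler1n.
  lra.
rewrite /cycle_mean; elim: k => [|k IHk].
  by rewrite big_nil !subrr mulr0 lexx.
have -> : iota 2 k.+1 = iota 2 k ++ [:: k.+2].
  by rewrite -[in LHS](addn1 k) iotaD.
rewrite map_cat big_cat /= big_seq1.
have := ln_succ_sub_le R k.+4; have := ln_succ_sub_ge R k.+1.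
have rate_ge : 2 * k.+4.+1%:R^-1 <= cycle_rate k.+2 :> R.
  rewrite /cycle_rate -mulrA ler_pM2l // ler_pdivlMr ?exprn_gt0 ?ltr0n //.
  rewrite mulrC ler_pdivrMr ?ltr0n //.
  rewrite -!natrX -natrM ler_nat; nia.
have rate_le : cycle_rate k.+2 <= 2 * (k.+3%:R)^-1 :> R.
  rewrite /cycle_rate -mulrA ler_pM2l // ler_pdivrMr ?exprn_gt0 ?ltr0n //.
  rewrite expr2 mulKf ?pnatr_eq0 // ler_nat; lia.
move: IHk rate_ge rate_le => /andP[].
move: (\sum_(r <- _) r) (cycle_rate k.+2) k.+1.+4%:R^-1 k.+3%:R^-1 => t r x y.
by lra.
Qed.

(** * The limit *)

Local Open Scope classical_set_scope.

Lemma cvg_inv_ln_sub (R : realType) (c : R) :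
  (fun n : nat => (ln n%:R - c)^-1) @ \oo --> (0 : R).
Proof.
apply/gtr0_cvgV0; last first.
  apply/cvgryPge => A; near=> n.
  rewrite lerBrDr -[A + c]expRK ler_ln ?posrE ?expR_gt0 //; last first.
    by rewrite ltr0n; near: n; exact: nbhs_infty_gt.
  by near: n; exact: nbhs_infty_ger.
near=> n.
rewrite subr_gt0 -[c]expRK ltr_ln ?posrE ?expR_gt0 //; last first.
  by rewrite ltr0n; near: n; exact: nbhs_infty_gt.
by near: n; exact: nbhs_infty_gtr.
Unshelve. all: by end_near. Qed.

Definition asymp_ratio (R : realType) (n : nat) : R :=
  prob_same_num_cycles R n / (1 / (2 * Num.sqrt (pi * ln n%:R))).
Arguments asymp_ratio {R}.

Lemma asymp_ratioE (R : realType) (k : nat) :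
  asymp_ratio k.+2 = Num.sqrt (pi * ln k.+2%:R) *
    bernoulli_mean [seq cycle_rate i | i <- iota 2 k]
      (fun m => return_prob m + return_prob m.+1) :> R.
Proof.
rewrite /asymp_ratio prob_same_num_cycles_fair_split div1r invrK.
by field.
Qed.

(** This is [sqrt (ln n / (ln n + 1))]; the reciprocal of [ln n] minus a
    constant is singled out so that the limit is that of one sequence. *)
Lemma asymp_ratio_ge (R : realType) (k : nat) :
  Num.sqrt (1 - (ln k.+2%:R - (-1))^-1) <= asymp_ratio k.+2 :> R.
Proof.
have L0 : 0 < ln k.+2%:R :> R by rewrite ln_gt0 // ltr1n.
rewrite asymp_ratioE; move: L0 (cycle_mean_bounds R k); set L := ln _ => L0.
rewrite /cycle_mean => /andP[_ mu_le].
have rs01 r : r \in [seq cycle_rate i | i <- iota 2 k] -> 0 <= (r : R) <= 1.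
  by move=> /mapP[i _ ->]; exact: cycle_rate01.
have := mean_return_prob_pair_ge rs01.
have mu0 : 0 <= \sum_(r <- [seq cycle_rate i | i <- iota 2 k]) (r : R).
  by rewrite big_seq sumr_ge0 // => r /rs01/andP[].
move: mu0 mu_le; set mu := \sum_(_ <- _) _ => mu0 mu_le.
move=> /(ler_wpM2l (sqrtr_ge0 (pi * L))); apply: le_trans.
have pi0 := pi_gt0 R.
rewrite -sqrtrV; last by lra.
rewrite -!sqrtrM ?mulr_ge0 ?divr_ge0 ?invr_ge0 ?(ltW pi0) ?(ltW L0) //.
have mu2_gt0 : 0 < mu + 2 by lra.
rewrite ler_sqrt; last first.
  apply: mulr_ge0; first by rewrite mulr_ge0 ?(ltW pi0) ?(ltW L0).
  by rewrite !divr_ge0 ?(ltW pi0) ?(ltW mu2_gt0).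
have -> : pi * L * (2 / pi / (mu + 2)) = 2 * L / (mu + 2).
  have mu2 := lt0r_neq0 mu2_gt0.
  by move: (@pi R) (lt0r_neq0 pi0) => p p0; field; rewrite ?p0 ?mu2.
have -> : 1 - (L - -1)^-1 = 2 * L / (2 * L + 2).
  have L1 : L + 1 != 0 by rewrite lt0r_neq0 ?addr_gt0.
  have L2 : 2 * L + 2 != 0 by rewrite lt0r_neq0 ?addr_gt0 ?mulr_gt0.
  by field; rewrite L1 L2.
have L2_gt0 : 0 < 2 * L + 2 by lra.
by rewrite ler_pM2l ?mulr_gt0 // lef_pV2 ?posrE // lerD2r.
Qed.

(** With [d = ln n - ln 5], the first factor is [sqrt (ln n / d)] and the
    second [1 + 2 / sqrt (2 * d)]. *)
Lemma asymp_ratio_le (R : realType) (k : nat) : ln 5 < ln k.+2%:R :> R ->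
  asymp_ratio k.+2 <= Num.sqrt (1 + ln 5 * (ln k.+2%:R - ln 5)^-1)
    * (1 + 2 * Num.sqrt ((ln k.+2%:R - ln 5)^-1 / 2)) :> R.
Proof.
move=> L5; have L0 : 0 < ln k.+2%:R :> R by rewrite ln_gt0 // ltr1n.
rewrite asymp_ratioE; move: L0 L5 (cycle_mean_bounds R k).
set L := ln _ => L0 L5.
rewrite /cycle_mean => /andP[mu_ge _].
have rs01 r : r \in [seq cycle_rate i | i <- iota 2 k] -> 0 <= (r : R) <= 1.
  by move=> /mapP[i _ ->]; exact: cycle_rate01.
have := mean_return_prob_pair_le rs01.
move: mu_ge; set mu := \sum_(_ <- _) _ => mu_ge.
have mu0 : 0 < mu by lra.
move=> /(_ mu0) /(ler_wpM2l (sqrtr_ge0 (pi * L))) /le_trans; apply.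
have pi0 := pi_gt0 R.
set d := L - ln 5; have d0 : 0 < d by rewrite /d; lra.
have mu_d : 2 * d <= mu by [].
have -> : 1 + ln 5 * d^-1 = (2 * L) / (2 * d).
  by rewrite /d; field; rewrite !lt0r_neq0.
rewrite mulrA -sqrtrM ?mulr_ge0 ?(ltW pi0) ?(ltW L0) //.
have -> : pi * L * (2 / pi) = 2 * L.
  by move: (@pi R) (lt0r_neq0 pi0) => p p0; field; rewrite p0.
have dd0 : 0 < 2 * d by rewrite mulr_gt0.
have -> : d^-1 / 2 = (2 * d)^-1 by rewrite invfM mulrC.
rewrite [Num.sqrt (2 * L / _)]sqrtrM ?mulr_ge0 ?(ltW L0) //.
rewrite sqrtrV ?(ltW dd0) // -mulrA ler_wpM2l ?sqrtr_ge0 //.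
have sd0 : 0 < Num.sqrt (2 * d) by rewrite sqrtr_gt0.
rewrite mulrDr mulr1 mulrCA -invfM -expr2 sqr_sqrtr ?(ltW dd0) //.
rewrite lerD ?ler_wpM2l ?lef_pV2 ?posrE ?sqrtr_gt0 //.
by rewrite ler_sqrt // ltW.
Qed.

Theorem theorem1 (R : realType) :
  asymp_equiv (fun n : nat => prob_same_num_cycles R n)
              (fun n : nat => 1 / (2 * Num.sqrt (pi * ln (n%:R : R)))).
Proof.
have sqrt_cvg (u : nat -> R) (l : R) :
    u @ \oo --> l -> (fun n => Num.sqrt (u n)) @ \oo --> Num.sqrt l.
  by move=> ul; apply: continuous_cvg => //; exact: sqrt_continuous.
apply: (@squeeze_cvgr _ _ _ _
  (fun n => Num.sqrt (1 - (ln n%:R - (-1))^-1))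
  (fun n => Num.sqrt (1 + ln 5 * (ln n%:R - ln 5)^-1)
    * (1 + 2 * Num.sqrt ((ln n%:R - ln 5)^-1 / 2)))).
- near=> n.
  have n2 : (2 <= n)%N by near: n; exact: nbhs_infty_ge.
  have n5 : (5 < n)%N by near: n; exact: nbhs_infty_gt.
  move: n2 n5; case: (n) => [//|[//|k]] _ k5.
  rewrite -/(asymp_ratio _) asymp_ratio_ge asymp_ratio_le //.
  by rewrite ltr_ln ?posrE ?ltr0n ?ltr_nat.
- rewrite -[in X in _ --> X]sqrtr1; apply: sqrt_cvg.
  rewrite -[in X in _ --> X](subr0 1); apply: cvgB; first exact: cvg_cst.
  exact: cvg_inv_ln_sub.
- have lim1 : Num.sqrt (1 + ln 5 * 0) * (1 + 2 * Num.sqrt (0 / 2)) = 1 :> R.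
    by rewrite mul0r sqrtr0 !mulr0 !addr0 sqrtr1 mulr1.
  rewrite -[in X in _ --> X]lim1.
  apply: cvgM.
    apply: sqrt_cvg; apply: cvgD; first exact: cvg_cst.
    by apply: cvgM; [exact: cvg_cst | exact: cvg_inv_ln_sub].
  apply: cvgD; first exact: cvg_cst.
  apply: cvgM; first exact: cvg_cst.
  apply: sqrt_cvg; apply: cvgM; last exact: cvg_cst.
  exact: cvg_inv_ln_sub.
Unshelve. all: by end_near. Qed.
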